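(* Let $P$ be a logic program over $\Sigma$ and $t\in\mathbf{Term}(\Sigma)$. (Inductive soundness of S-resolution) If there is an S-refutation for $P$ and $t$ that computes answer $\theta$, and $t'$ is a ground instance of $\theta(t)$, then $t'\in M_P$. (Inductive completeness of S-resolution) If $t\in M_P$, then there exists a term $t'\in\mathbf{Term}(\Sigma)$ for which there is an S-refutation for $P$ and $t'$ computing an answer $\theta\in\mathbf{Subst}(\Sigma)$ such that $t$ is an instance of $\theta(t')$.
   Context: Terms are finite first-order terms with variables over a signature $\Sigma$ containing at least one constant; $\mathbf{Subst}(\Sigma)$ denotes substitutions with finite-term codomain. A clause is $A\gets B_0,\ldots,B_m$ (body possibly empty); a goal clause is $?\gets B_0,\ldots,B_m$; a logic program $P$ is a finite list $P(0),\ldots,P(k)$ of non-goal clauses, viewed as functions on $\{\epsilon,0,\ldots,m\}$ ($C(\epsilon)$ the head). $s\prec_\theta u$: $\theta$ is a most general matcher of $s$ against $u$; $s\sim_\theta u$: $\theta$ is a most general unifier. Clause variables are renamed apart. $M_P$ is the least set of finite ground terms such that for each clause $A\gets B_1,\ldots,B_n$ of $P$ and grounding $\sigma$, $\sigma(B_1),\ldots,\sigma(B_n)\in M_P$ implies $\sigma(A)\in M_P$. Rewriting tree $T=\mathrm{rew}(P,C,\sigma)$ ($\sigma$ idempotent; $V_R$ a set of or-node variables): $T(\epsilon)=\sigma(C)$, $T(i)=\sigma(C(i))$ for body positions $i$ of $C$; each odd-length node $w$ is a term with, for every clause index $i$, a child $wi$ labelled $\sigma(\theta(P(i)))$ if $\mathrm{head}(P(i))\prec_\theta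 T(w)$, else a fresh variable of $V_R$; even positive-length nodes are clauses or variables; variables are leaves; a clause node $\sigma(\theta(P(i)))$ at $w$ has children $wj$ labelled $\sigma(\theta(P(i)(j)))$ for body positions $j$. A rewriting subtree contains the root, all children of its even-depth nodes, exactly one child of each of its odd-depth nodes. An inductive success tree is one having a finite rewriting subtree whose leaves are all non-variable leaf or-nodes. Tree transition: if $T=\mathrm{rew}(P,C,\sigma)$ and $X=T(wi)\in V_R$, let $\theta$ be such that $\mathrm{head}(P(i))\sim_\theta T(w)$ (the external resolvent); if no such $\theta$ exists, $T_X$ is the empty tree, otherwise $T_X=\mathrm{rew}(P,C,\theta\sigma)$; write $T\to T_X$. An S-derivation for $P$ and $t$ is a sequence $T_0=\mathrm{rew}(P,?\gets t,\mathit{id})\to T_1\to\cdots$ of tree transitions; with resolvents $\theta_1,\theta_2,\ldots$ one has $T_k=\mathrm{rew}(P,?\gets t,\theta_k\cdots\theta_1)$. An S-refutation is a finite S-derivation $T_0\to\cdots\to T_n$ with $T_n$ an inductive success tree; it computes the answer $\theta_n\cdots\theta_1$. *)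

(* Defs.v *)
From mathcomp Require Import all_boot.

Set Implicit Arguments.
Unset Strict Implicit.
Unset Printing Implicit Defensive.

Record signature := Signature { symb :> Type; arity : symb -> nat }.

Definition has_constant (S : signature) : Prop := exists c : S, arity c = 0.

Definition var := nat.

(* Finite functions make Leibniz equality of terms the structural one. *)
Inductive term (S : signature) : Type :=
| Var of var
| App (f : S) of {ffun 'I_(arity f) -> term S}.

Arguments Var {S} x.
Arguments App {S} f ts.

Fixpoint occurs S (x : var) (t : term S) : Prop :=
  match t with
  | Var y => x = y
  | App _ ts => exists i, occurs x (ts i)
  end.

Definition ground S (t : term S) : Prop := forall x, ~ occurs x t.

Definition substitution S := var -> term S.

Fixpoint tsubst S (s : substitution S) (t : term S) : term S :=
  match t with
  | Var x => s x
  | App f ts => App f [ffun i => tsubst s (ts i)]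
  end.

Definition idsub S : substitution S := fun x => Var x.

(* [scomp s1 s2] is the juxtaposition s1 s2: s2 is applied first. *)
Definition scomp S (s1 s2 : substitution S) : substitution S :=
  fun x => tsubst s1 (s2 x).

Definition idempotent_sub S (s : substitution S) : Prop := scomp s s =1 s.

Definition grounding S (s : substitution S) : Prop := forall x, ground (s x).

Definition instance_of S (u t : term S) : Prop := exists s, u = tsubst s t.

(* Most general unifier, where [th] is more general than [ta] when [ta] factors
   as [scomp d th]. *)
Definition mgu S (t u : term S) (th : substitution S) : Prop :=
  tsubst th t = tsubst th u /\
  forall ta : substitution S, tsubst ta t = tsubst ta u ->
    exists d : substitution S, scomp d th =1 ta.

(* Most general matcher of [t] against [u].  Generality is compared on the
   variables of [t], and a matcher is standardized to be the identity elsewhere: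
   comparing on all variables would rule out {X |-> Y} as an mgm of p(X) against
   p(Y), since the matcher {X |-> Y, Y |-> Z} does not factor through it, and
   would let an mgm move the body-only variables of the clause whose head is
   matched. *)
Definition mgm S (t u : term S) (th : substitution S) : Prop :=
  [/\ tsubst th t = u,
      forall ta : substitution S, tsubst ta t = u ->
        exists d : substitution S, forall x, occurs x t -> scomp d th x = ta x
    & forall x, ~ occurs x t -> th x = Var x].

(* Non-goal clauses. *)
Record rule S := Rule { head : term S; body : seq (term S) }.

Inductive clause S :=
| RuleClause of rule S
| GoalClause of seq (term S).

Definition cbody S (C : clause S) : seq (term S) :=
  match C with RuleClause K => body K | GoalClause Bs => Bs end.

Definition rsubst S (s : substitution S) (K : rule S) : rule S :=
  Rule (tsubst s (head K)) (map (tsubst s) (body K)).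

Definition csubst S (s : substitution S) (C : clause S) : clause S :=
  match C with
  | RuleClause K => RuleClause (rsubst s K)
  | GoalClause Bs => GoalClause (map (tsubst s) Bs)
  end.

Definition occurs_clause S (x : var) (C : clause S) : Prop :=
  (exists2 K, C = RuleClause K & occurs x (head K)) \/
  (exists j B, onth (cbody C) j = Some B /\ occurs x B).

Definition program S := seq (rule S).

Inductive lhm S (P : program S) : term S -> Prop :=
| LHM (i : nat) (K : rule S) (s : substitution S) :
    onth P i = Some K -> grounding s ->
    (forall j B, onth (body K) j = Some B -> lhm P (tsubst s B)) ->
    lhm P (tsubst s (head K)).

Definition position := seq nat.

(* [ren C w] renames the variables of the program clause used at the or-node
   position [w] of a rewriting tree with root clause [C].  A transition replaces
   rew(P,C,s) by rew(P,C,th s), and [th] has to instantiate the body-only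
   variables already present in the tree; the renaming therefore depends on the
   position and not on the substitution, and the resolvent at an open or-node
   uses the same copy of the clause. *)
Record renaming S := Renaming {
  ren :> clause S -> position -> var -> var;
  ren_inj : forall C w w' x x',
    ren C w x = ren C w' x' -> w = w' /\ x = x';
  ren_apart : forall C w x, ~ occurs_clause (ren C w x) C }.

Definition variant S (r : var -> var) (K : rule S) : rule S :=
  rsubst (fun x => Var (r x)) K.

(* [LOpen X] is an or-node labelled with the variable X of V_R. *)
Inductive label S :=
| LTerm of term S
| LClause of clause S
| LOpen of nat.

Arguments LOpen {S} X.

Definition tree S := position -> option (label S).

Definition empty_tree S (T : tree S) : Prop := forall w, T w = None.

Section Trees.
Variables (S : signature) (rn : renaming S) (P : program S).

(* [w] is a term node labelled [u] of rew(P,C,s), and [i] a child index. *)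
Definition or_child (C : clause S) (s : substitution S) (T : tree S)
    (w : position) (u : term S) (i : nat) : Prop :=
  let wi := rcons w i in
  if onth P i is Some K then
    let K' := variant (rn C wi) K in
    (forall th, mgm (head K') u th ->
       T wi = Some (LClause (RuleClause (rsubst s (rsubst th K')))) /\
       forall j, T (rcons wi j) =
         omap (fun B => LTerm (tsubst s (tsubst th B))) (onth (body K') j))
    /\ ((forall th, ~ mgm (head K') u th) -> exists X, T wi = Some (LOpen X))
  else T wi = None.

(* T = rew(P,C,s), which is determined up to the choice of the fresh or-node
   variables. *)
Record is_rew (C : clause S) (s : substitution S) (T : tree S) : Prop := IsRew {
  rew_idem : idempotent_sub s;
  rew_root : T [::] = Some (LClause (csubst s C));
  rew_goals : forall i,
    T [:: i] = omap (fun B => LTerm (tsubst s B)) (onth (cbody C) i);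
  rew_or : forall w u i, odd (size w) -> T w = Some (LTerm u) ->
    or_child C s T w u i;
  rew_open_leaf : forall w X i, T w = Some (LOpen X) -> T (rcons w i) = None;
  rew_dom : forall w i, T w = None -> T (rcons w i) = None;
  rew_fresh : forall w w' X,
    T w = Some (LOpen X) -> T w' = Some (LOpen X) -> w = w' }.

(* The positions selected by [U] form a rewriting subtree of T. *)
Record rewriting_subtree (T : tree S) (U : position -> Prop) : Prop := {
  sub_root : U [::];
  sub_dom : forall w, U w -> T w <> None;
  sub_prefix : forall w i, U (rcons w i) -> U w;
  sub_even : forall w i, ~~ odd (size w) -> U w ->
    T (rcons w i) <> None -> U (rcons w i);
  sub_odd : forall w, odd (size w) -> U w -> exists! i, U (rcons w i) }.

Definition finite_subtree (U : position -> Prop) : Prop :=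
  exists ws : seq position, forall w, U w -> w \in ws.

Definition closed_leaf (T : tree S) (w : position) : Prop :=
  [/\ 0 < size w, ~~ odd (size w), exists D, T w = Some (LClause D)
    & forall i, T (rcons w i) = None].

Definition inductive_success (T : tree S) : Prop :=
  exists U : position -> Prop,
    [/\ rewriting_subtree T U, finite_subtree U
      & forall w, U w -> (forall i, ~ U (rcons w i)) -> closed_leaf T w].

(* The transition T -> T_X from T = rew(P,C,s) with external resolvent [th].
   If there is no unifier then T_X is the empty tree and [th] is irrelevant. *)
Definition tree_transition (C : clause S) (s : substitution S) (T : tree S)
    (th : substitution S) (T' : tree S) : Prop :=
  is_rew C s T /\
  exists w i X u K,
    [/\ T (rcons w i) = Some (LOpen X), T w = Some (LTerm u), onth P i = Some K
      & let A := head (variant (rn C (rcons w i)) K) in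
        (mgu A u th /\ is_rew C (scomp th s) T') \/
        ((forall th', ~ mgu A u th') /\ empty_tree T')].

(* [answer th k] is th_k ... th_1, where [th k] stands for th_(k+1). *)
Fixpoint answer (th : nat -> substitution S) (k : nat) : substitution S :=
  if k is k'.+1 then scomp (th k') (answer th k') else @idsub S.

Definition S_derivation (t : term S) (n : nat)
    (T : nat -> tree S) (th : nat -> substitution S) : Prop :=
  is_rew (GoalClause [:: t]) (@idsub S) (T 0) /\
  forall k, k < n ->
    tree_transition (GoalClause [:: t]) (answer th k) (T k) (th k) (T k.+1).

Definition S_refutation (t : term S) (ans : substitution S) : Prop :=
  exists n T th,
    [/\ S_derivation t n T th, inductive_success (T n) & ans =1 answer th n].

End Trees.

Fixpoint vbound S (t : term S) : nat :=
  match t with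
  | Var x => x.+1
  | App _ ts => sumn (codom (@vbound S \o ts))
  end.

Lemma occurs_vbound S : forall (x : var) (t : term S), occurs x t -> x < vbound t.
Proof.
move=> x; fix IH 1 => -[y /= -> //|f ts /= [i /IH lti]].
apply: leq_trans lti _; rewrite sumnE big_map big_enum /=.
by rewrite (bigD1 i) //= leq_addr.
Qed.

Definition cbound S (C : clause S) : nat :=
  (if C is RuleClause K then vbound (head K) else 0) +
  sumn (map (@vbound S) (cbody C)).

Lemma occurs_cbound S (x : var) (C : clause S) : occurs_clause x C -> x < cbound C.
Proof.
case=> [[K -> /occurs_vbound lt] | [j [B [jB /occurs_vbound lt]]]].
  exact: leq_trans lt (leq_addr _ _).
apply: leq_trans lt _; apply: leq_trans (leq_addl _ _).
elim: (cbody C) j jB => [|B' Bs IH] [|j] //= => [[->]|/IH le]; first exact: leq_addr.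
exact: leq_trans le (leq_addl _ _).
Qed.

Definition std_renaming S : renaming S.
Proof.
exists (fun C w x => cbound C + pickle (w, x)) => [C w w' x x'|C w x].
  by move/addnI/(pcan_inj pickleK) => [].
by move/occurs_cbound; rewrite ltnNge leq_addr.
Defined.

(* Main.v *)
Require Import Defs.
From mathcomp Require Import all_boot.
From Stdlib Require Import ClassicalEpsilon.

Set Implicit Arguments.
Unset Strict Implicit.
Unset Printing Implicit Defensive.

(* Soundness: at a fixed tree rew(P,C,s) every node label is fixed by s, so a
   grounding d turns the clause instance s th K' at a closed or-node into a ground
   instance of K whose head is the d-instance of the term above it; going up a
   finite success subtree this puts all its instantiated terms in M_P.

   Completeness: one can take t' = t, which is ground.  A derivation of t in M_P
   assigns to every or-node it uses a grounding of the clause copy used there;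
   since copies at distinct positions share no variables, these assignments amount
   to one substitution ga solving all the equations "head of the copy = term above
   it".  The S-derivation is steered by the invariant ga s = ga.  At an or-node
   that is open in rew(P,C,s), ga unifies the two terms, so a most general unifier
   th exists and satisfies ga th = ga, and the transition preserves the
   invariant.  Nodes and successful subtrees persist under transitions, because
   the labels of rew(P,C,d s) are the d-instances of those of rew(P,C,s). *)

(** * Substitutions, unification and matching *)

Section Terms.
Variable S : signature.
Implicit Types (t u : term S) (s d th : substitution S) (x y : var) (V : var -> Prop).

Lemma term_nested_ind (Q : term S -> Prop) :
  (forall x, Q (Var x)) ->
  (forall f (ts : {ffun 'I_(arity f) -> term S}),
     (forall i, Q (ts i)) -> Q (App f ts)) ->
  forall t, Q t.
Proof. by move=> QV QA; fix IH 1 => -[x|f ts]; [exact: QV | apply: QA]. Qed.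

Lemma App_inj f (ts us : {ffun 'I_(arity f) -> term S}) :
  App f ts = App f us -> ts = us.
Proof. by move=> e; injection e => e'; exact: inj_pair2 e'. Qed.

Lemma eq_tsubst_in s s' t :
  (forall x, occurs x t -> s x = s' x) <-> tsubst s t = tsubst s' t.
Proof.
elim/term_nested_ind: t => [x|f ts IH] /=; split.
- by apply.
- by move=> eq_x _ ->.
- move=> eq_s; congr App; apply/ffunP=> i; rewrite !ffunE.
  by apply/IH => x xi; apply: eq_s; exists i.
- move=> /App_inj/ffunP eq_ts x [i xi].
  by move: (eq_ts i); rewrite !ffunE => /IH; apply.
Qed.

Lemma eq_tsubst s s' t : s =1 s' -> tsubst s t = tsubst s' t.
Proof. by move=> eq_s; apply/eq_tsubst_in. Qed.

Lemma tsubst_scomp s s' t : tsubst (scomp s s') t = tsubst s (tsubst s' t).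
Proof.
elim/term_nested_ind: t => [//|f ts IH] /=.
by congr App; apply/ffunP=> i; rewrite !ffunE.
Qed.

Lemma tsubst_id t : tsubst (@idsub S) t = t.
Proof.
elim/term_nested_ind: t => [//|f ts IH] /=.
by congr App; apply/ffunP=> i; rewrite !ffunE.
Qed.

Lemma tsubst_fix s t : tsubst s t = t <-> forall x, occurs x t -> s x = Var x.
Proof. by rewrite -{2}[t]tsubst_id eq_tsubst_in. Qed.

Lemma occurs_tsubst s t y :
  occurs y (tsubst s t) <-> exists2 x, occurs x t & occurs y (s x).
Proof.
elim/term_nested_ind: t => [x|f ts IH] /=; split.
- by exists x.
- by case=> _ ->.
- by case=> i; rewrite ffunE => /IH [x xi yx]; exists x => //; exists i.
- by case=> x [i xi] yx; exists i; rewrite ffunE; apply/IH; exists x.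
Qed.

Lemma ground_tsubst s t : ground t -> tsubst s t = t.
Proof. by move=> gt; apply/tsubst_fix => x /gt. Qed.

Lemma grounding_tsubst s t : grounding s -> ground (tsubst s t).
Proof. by move=> gs y /occurs_tsubst [x _ /gs]. Qed.

Lemma idempotent_tsubst s t :
  idempotent_sub s -> tsubst s (tsubst s t) = tsubst s t.
Proof. by move=> idem_s; rewrite -tsubst_scomp; exact: eq_tsubst. Qed.

(** Confinement to [V] in both domain and values: this is what lets the resolvents found for one
    part of a tree leave all other clause copies alone. *)
Definition supported V s : Prop := forall x,
  (V x -> forall y, occurs y (s x) -> V y) /\ (~ V x -> s x = Var x).

Lemma supported_id V : supported V (@idsub S).
Proof. by move=> x; split=> // Vx y ->. Qed.

Lemma supported_occurs V s t y :
  supported V s -> (forall x, occurs x t -> V x) -> occurs y (tsubst s t) -> V y.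
Proof. by move=> Vs Vt /occurs_tsubst [x /Vt Vx]; apply: (Vs x).1. Qed.

Lemma supported_sub V V' s :
  (forall x, V x -> V' x) -> supported V s -> supported V' s.
Proof.
move=> VV' Vs x; split=> [V'x y|nV'x]; last by apply: (Vs x).2 => /VV'.
have [Vx|nVx] := classic (V x); first by move/((Vs x).1 Vx)/VV'.
by rewrite ((Vs x).2 nVx) /= => ->.
Qed.

Lemma supported_scomp V s s' :
  supported V s -> supported V s' -> supported V (scomp s s').
Proof.
move=> Vs Vs' x; split=> [Vx y|nVx].
  by apply: supported_occurs => // z; apply: (Vs' x).1.
by rewrite /scomp ((Vs' x).2 nVx) /= ((Vs x).2 nVx).
Qed.

Fixpoint tsize t : nat :=
  match t with
  | Var _ => 1
  | App _ ts => (sumn (codom (@tsize \o ts))).+1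
  end.

Lemma tsize_arg f (ts : {ffun 'I_(arity f) -> term S}) i :
  tsize (ts i) < tsize (App f ts).
Proof.
by rewrite /= ltnS sumnE big_map big_enum /= (bigD1 i) //= leq_addr.
Qed.

Lemma tsize_occurs s t x : occurs x t -> tsize (s x) <= tsize (tsubst s t).
Proof.
elim/term_nested_ind: t => [y /= -> //|f ts IH] [i /IH le_i] /=.
apply: leq_trans le_i (ltnW _).
by have := tsize_arg [ffun i => tsubst s (ts i)] i; rewrite ffunE.
Qed.

(** By size: if [x] occurred strictly inside [t], then [tsubst s t] would be larger than [s x]. *)
Lemma occurs_check s t x :
  occurs x t -> s x = tsubst s t -> t = Var x.
Proof.
case: t => [y /= -> //|f ts] [i xi] eq_sx.
have := tsize_arg [ffun i => tsubst s (ts i)] i.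
by rewrite ffunE ltnNge -[App _ _]/(tsubst s (App f ts)) -eq_sx tsize_occurs.
Qed.

(* Strong most general unifiers: every unifier [ta] absorbs [th]; taking
   [ta := th] gives idempotence. *)
Definition solves V th (E : substitution S -> Prop) : Prop :=
  [/\ E th, forall ta, E ta -> scomp ta th =1 ta & supported V th].

(** The solution [s] excludes failure of the occurs check: if [x] occurs in [t], then [t] is [x] and
    the identity solves; otherwise binding [x] to [t] does. *)
Lemma unify_var V s x t :
  s x = tsubst s t -> V x -> (forall y, occurs y t -> V y) ->
  exists th, solves V th (fun ta => ta x = tsubst ta t).
Proof.
move=> sx Vx Vt; have [xt|nxt] := classic (occurs x t).
  rewrite (occurs_check xt sx); exists (@idsub S); split=> //.
  exact: supported_id.
pose th : substitution S := fun y => if y == x then t else Var y.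
have fix_t : tsubst th t = t.
  apply/tsubst_fix => y yt; rewrite /th; case: eqP => // eyx.
  by case: nxt; rewrite -eyx.
exists th; split.
- by rewrite fix_t /th eqxx.
- by move=> ta eq_ta y; rewrite /scomp /th; case: eqP => // ->.
- move=> y; rewrite /th; split=> [Vy z|nVy]; case: eqP => [eyx|_] //.
  + exact: Vt.
  + by move=> /= ->.
  + by case: nVy; rewrite eyx.
Qed.

(* Structural induction on the common instance [g] terminates: the unifiers of
   the first arguments are absorbed by [s], so they leave [g] unchanged. *)
Lemma unify V s g t u :
  tsubst s t = g -> tsubst s u = g ->
  (forall x, occurs x t -> V x) -> (forall x, occurs x u -> V x) ->
  exists th, solves V th (fun ta => tsubst ta t = tsubst ta u).
Proof.
elim/term_nested_ind: g t u => [z|f gs IH] [x|f1 ts] [y|f2 us] st su Vt Vu.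
- by apply: unify_var (etrans st (esym su)) (Vt _ erefl) Vu.
- by apply: unify_var (etrans st (esym su)) (Vt _ erefl) Vu.
- by [].
- by [].
- by apply: unify_var (etrans st (esym su)) (Vt _ erefl) Vu.
- by apply: unify_var (etrans st (esym su)) (Vt _ erefl) Vu.
- have [th [thE thG thV]] := unify_var (etrans su (esym st)) (Vu _ erefl) Vt.
  by exists th; split=> // ta /esym /thG.
move: (st) (su) => /= [ef1 _] [ef2 _]; subst f1 f2.
have {}st i : tsubst s (ts i) = gs i by rewrite -(App_inj st) ffunE.
have {}su i : tsubst s (us i) = gs i by rewrite -(App_inj su) ffunE.
(* The argument equations are solved from left to right; [E m] collects the first [m] of them. *)
pose E m ta := forall i : 'I_(arity f), i < m -> tsubst ta (ts i) = tsubst ta (us i).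
suff [th [thE thG thV]] : exists th, solves V th (E (arity f)).
  exists th; split=> //.
    by congr App; apply/ffunP=> i; rewrite !ffunE thE.
  move=> ta /App_inj/ffunP eq_ta; apply: thG => i _.
  by have := eq_ta i; rewrite !ffunE.
suff : forall m, m <= arity f -> exists th, solves V th (E m) by exact.
elim=> [_|m IHm lt_m]; first by exists (@idsub S); split=> //; exact: supported_id.
have [th [thE thG thV]] := IHm (ltnW lt_m).
pose i := Ordinal lt_m.
have s_th : scomp s th =1 s.
  by apply: thG => j _; rewrite st su.
have s_tht v : tsubst s (tsubst th v) = tsubst s v.
  by rewrite -tsubst_scomp; exact: eq_tsubst.
have [|||| th' [th'E th'G th'V]] := IH i (tsubst th (ts i)) (tsubst th (us i)).
- by rewrite s_tht st.
- by rewrite s_tht su.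
- by move=> x; apply: supported_occurs => // y yi; apply: Vt; exists i.
- by move=> x; apply: supported_occurs => // y yi; apply: Vu; exists i.
exists (scomp th' th); split; last exact: supported_scomp.
  move=> j; rewrite ltnS leq_eqVlt => /orP [/eqP ej|/thE eq_j].
    by have -> : j = i by [apply: val_inj]; rewrite !tsubst_scomp.
  by rewrite !tsubst_scomp eq_j.
move=> ta Eta; have ta_th : scomp ta th =1 ta.
  by apply: thG => j lt_j; apply: Eta; exact: ltnW.
have ta_th' : scomp ta th' =1 ta.
  apply: th'G; rewrite -!tsubst_scomp !(eq_tsubst _ ta_th); exact: Eta.
by move=> x; rewrite /scomp -tsubst_scomp (eq_tsubst _ ta_th') -[RHS]ta_th.
Qed.

(** Matchers agree on the variables of [t], so any one of them, reset to the identity elsewhere, is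
    most general. *)
Lemma mgm_exists s t u : tsubst s t = u -> exists th, mgm t u th.
Proof.
move=> st; pose th x := if excluded_middle_informative (occurs x t) then s x else Var x.
have th_t x : occurs x t -> th x = s x.
  by rewrite /th; case: excluded_middle_informative.
exists th; split; first by rewrite -st; apply/eq_tsubst_in.
  move=> ta tat; exists (@idsub S) => x xt; rewrite /scomp tsubst_id th_t //.
  by move: x xt; apply/eq_tsubst_in; rewrite st.
by move=> x nxt; rewrite /th; case: excluded_middle_informative.
Qed.

Lemma mgm_unique t u th th' : mgm t u th -> mgm t u th' -> th =1 th'.
Proof.
move=> [tht _ thn] [th't _ th'n] x; have [|nxt] := classic (occurs x t).
  by move: x; apply/eq_tsubst_in; rewrite tht.
by rewrite thn // th'n.
Qed.

(* The children of a matched node are instantiated by [d] along with it. *)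
Lemma mgm_lift s s' d t u th :
  idempotent_sub s -> idempotent_sub s' -> s' =1 scomp d s ->
  tsubst s u = u -> mgm t u th ->
  exists2 th', mgm t (tsubst d u) th' &
    forall B, tsubst s' (tsubst th' B) = tsubst d (tsubst s (tsubst th B)).
Proof.
move=> idem_s idem_s' s's su [tht _ thn].
have dt : tsubst (scomp d th) t = tsubst d u by rewrite tsubst_scomp tht.
have [th' th'm] := mgm_exists dt; exists th' => // B.
have [th't _ th'n] := th'm.
have s'E v : tsubst s' v = tsubst d (tsubst s v).
  by rewrite -tsubst_scomp; exact: eq_tsubst.
rewrite -s'E -!tsubst_scomp; apply: eq_tsubst => x; rewrite /scomp.
have [xt|nxt] := classic (occurs x t); last by rewrite th'n ?thn.
(* On the variables of [t], [th x] is part of [u] and hence fixed by [s]; so [d] acts on it as [s']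
   does, and idempotence of [s'] concludes. *)
have -> : th' x = tsubst d (th x).
  by move: x xt; apply/eq_tsubst_in; rewrite th't.
have s_thx : tsubst s (th x) = th x.
  apply/tsubst_fix => y yx; apply: ((tsubst_fix s u).1 su).
  by rewrite -tht; apply/occurs_tsubst; exists x.
by rewrite -[in LHS]s_thx -!s'E idempotent_tsubst -1?s'E ?s_thx.
Qed.

(** Composition does not preserve idempotence in general. Here [th] moves only variables of [V] and
    keeps them in [V], where [s] is the identity, while the variables in the values of [s] are fixed
    by [s]. *)
Lemma idempotent_scomp s th V :
  idempotent_sub s -> idempotent_sub th -> supported V th ->
  (forall x, V x -> s x = Var x) -> idempotent_sub (scomp th s).
Proof.
move=> idem_s idem_th thV sV x; rewrite -[RHS]/(tsubst th (s x)).
rewrite -[LHS]/(tsubst (scomp th s) (tsubst th (s x))) -tsubst_scomp.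
apply/eq_tsubst_in => y yx; rewrite /scomp tsubst_scomp.
have sy : s y = Var y by move: y yx; apply/tsubst_fix; exact: idem_s.
have [Vy|nVy] := classic (V y); last by rewrite (thV y).2 //= sy /= (thV y).2.
rewrite (tsubst_fix s _).2; first exact: idem_th.
by move=> z zy; apply/sV/((thV y).1 Vy).
Qed.

End Terms.

(** * Soundness *)

Section Soundness.
Variables (S : signature) (rn : renaming S) (P : program S) (C : clause S).

Lemma finite_subtree_bound (U : position -> Prop) :
  finite_subtree U -> exists N, forall w, U w -> size w <= N.
Proof.
case=> ws Uws; exists (\max_(w <- ws) size w) => w /Uws ws_w.
by rewrite (big_rem w) //= leq_maxl.
Qed.

Lemma subtree_sound s T U (d : substitution S) :
  is_rew rn P C s T -> rewriting_subtree T U -> finite_subtree U ->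
  (forall w, U w -> (forall i, ~ U (rcons w i)) -> closed_leaf T w) ->
  grounding d ->
  forall w u, odd (size w) -> U w -> T w = Some (LTerm u) ->
    tsubst s u = u -> lhm P (tsubst d u).
Proof.
move=> Trew Usub /finite_subtree_bound [N UN] Uleaf gd w.
(* Induction on the remaining depth: [N] bounds the length of the positions in [U]. *)
have [n le_n] : exists n, N - size w < n by exists (N - size w).+1.
elim: n w le_n => // n IH w le_n u odd_w Uw Tw su.
have [i [Uwi _]] := sub_odd Usub odd_w Uw.
have even_wi : ~~ odd (size (rcons w i)) by rewrite size_rcons /= odd_w.
have := rew_or Trew i odd_w Tw; rewrite /or_child /=.
case PK: (onth P i) => [K|]; last by move/(sub_dom Usub Uwi).
set K' := variant _ _; case=> closed open.
(* If the or-node chosen by [U] were open, it would be a leaf of [U] not labelled with a clause. *)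
have [[th th_m]|no_th] := classic (exists th, mgm (Defs.head K') u th); last first.
  have [|X TX] := open; first by move=> th th_m; apply: no_th; exists th.
  have [|_ _ [D]] := Uleaf _ Uwi; last by rewrite TX.
  by move=> j /(sub_dom Usub); rewrite (rew_open_leaf Trew j TX).
have [Twi Twij] := closed _ th_m.
pose v (x : var) : term S := Var (rn C (rcons w i) x).
(* The grounding required by [LHM], read off the tree: rename apart, match, apply [s], ground by
   [d]. *)
pose sg := scomp d (scomp s (scomp th v)).
have sgE B : tsubst sg B = tsubst d (tsubst s (tsubst th (tsubst v B))).
  by rewrite !tsubst_scomp.
have -> : tsubst d u = tsubst sg (Defs.head K).
  by rewrite sgE; case: th_m => -> _ _; rewrite su.
apply: (LHM PK) => [x|j B jB]; first exact: grounding_tsubst.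
have TB : T (rcons (rcons w i) j) = Some (LTerm (tsubst s (tsubst th (tsubst v B)))).
  by rewrite Twij /= onth_map jB.
rewrite sgE; apply: (IH _ _ _ _ _ TB).
- have := UN _ Uwi; rewrite !size_rcons => lt_w.
  rewrite -ltnS; apply: leq_trans le_n; rewrite ltnS.
  by rewrite ltn_sub2l // (leq_trans _ lt_w).
- by rewrite size_rcons /= even_wi.
- by apply: (sub_even Usub); rewrite ?TB.
- exact/idempotent_tsubst/(rew_idem Trew).
Qed.

End Soundness.

Lemma success_sound (S : signature) (rn : renaming S) (P : program S)
    (C : clause S) (s d : substitution S) (T : tree S) i B :
  is_rew rn P C s T -> inductive_success T -> grounding d ->
  onth (cbody C) i = Some B -> lhm P (tsubst d (tsubst s B)).
Proof.
move=> Trew [U [Usub Ufin Uleaf]] gd CB.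
have TB : T [:: i] = Some (LTerm (tsubst s B)) by rewrite (rew_goals Trew) CB.
apply: (subtree_sound Trew Usub Ufin Uleaf gd _ _ TB) => //.
  by apply: (@sub_even _ _ _ Usub [::]); rewrite ?TB //; exact: sub_root Usub.
exact/idempotent_tsubst/(rew_idem Trew).
Qed.

Lemma derivation_is_rew (S : signature) (rn : renaming S) (P : program S)
    (t : term S) n (T : nat -> tree S) th :
  S_derivation rn P t n T th ->
  is_rew rn P (GoalClause [:: t]) (answer th n) (T n) \/ empty_tree (T n).
Proof.
case: n => [|n] [T0 step]; first by left.
have [_ [w [i [X [u [K [_ _ _ /= [[_ Tn]|[_ Tn]]]]]]]]] := step n (ltnSn n).
  by left.
by right.
Qed.

Lemma refutation_sound (S : signature) (rn : renaming S) (P : program S)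
    (t t' : term S) (theta : substitution S) :
  has_constant S -> S_refutation rn P t theta -> ground t' ->
  instance_of t' (tsubst theta t) -> lhm P t'.
Proof.
move=> [c c0] [n [T [th [der suc eq_th]]]] gt' [s t'E].
have [Trew|T0] := derivation_is_rew der; last first.
  by have [U [Usub _ _]] := suc; case: (sub_dom Usub (sub_root Usub)).
(* With arity 0 the argument function has an empty domain, so its default value [Var 0] does not
   occur. *)
have c_ground : ground (App c [ffun _ => Var 0]).
  by move=> x /= [i]; have := ltn_ord i; rewrite {2}c0.
(* [s] may leave variables; sending them to a constant makes it grounding and does not change the
   ground term [t']. *)
pose k : substitution S := fun _ => App c [ffun _ => Var 0].
have gd : grounding (scomp k s) by move=> x; apply: grounding_tsubst => y.
have := success_sound (i := 0) (B := t) Trew suc gd erefl.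
by rewrite tsubst_scomp -(eq_tsubst _ eq_th) -t'E ground_tsubst.
Qed.

(** * Success subtrees *)

Section Subtrees.
Variables (S : signature) (T : tree S).
Implicit Types (w p q : position) (ws : seq position).

(** A version of successful subtrees rooted at an arbitrary [w], so that they can be glued from the
    leaves up: [sb_prefix] stops at [w], and listing the positions carries finiteness. *)
Record success_below w ws : Prop := SuccessBelow {
  sb_root : w \in ws;
  sb_ext : forall p, p \in ws -> exists q, p = w ++ q;
  sb_dom : forall p, p \in ws -> T p <> None;
  sb_prefix : forall p i, rcons p i \in ws -> rcons p i = w \/ p \in ws;
  sb_even : forall p i, ~~ odd (size p) -> p \in ws ->
    T (rcons p i) <> None -> rcons p i \in ws;
  sb_odd : forall p, odd (size p) -> p \in ws -> exists! i, rcons p i \in ws;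
  sb_leaf : forall p, p \in ws -> (forall i, rcons p i \notin ws) ->
    closed_leaf T p }.

Lemma rcons_cat_inj w j j' q q' : rcons w j ++ q = rcons w j' ++ q' -> j = j'.
Proof.
by rewrite !cat_rcons => /(congr1 (drop (size w))); rewrite !drop_size_cat // => -[].
Qed.

Lemma rcons_cat_neq w j q : rcons w j ++ q <> w.
Proof.
move/(congr1 size)/eqP; rewrite size_cat size_rcons addSnnS.
by rewrite -[X in _ == X]addn0 eqn_add2l.
Qed.

Lemma success_below_term w i ws :
  odd (size w) -> T w <> None -> success_below (rcons w i) ws ->
  success_below w (w :: ws).
Proof.
move=> odd_w Tw [root ext dom pre even oddP leaf].
have nw q : q \in ws -> q <> w by move/ext => [q' ->]; exact: rcons_cat_neq.
split=> [|p|p|p k|p k|p|p]; rewrite ?in_cons ?eqxx //.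
- case/predU1P => [->|/ext [q ->]]; first by exists [::]; rewrite cats0.
  by exists (i :: q); rewrite cat_rcons.
- by case/predU1P => [->|/dom].
- case/predU1P => [->|/pre [/rcons_inj [-> _]|->]]; first by left.
    by right; rewrite eqxx.
  by right; rewrite orbT.
- move=> even_p /predU1P [epw|p_ws] Tpk; first by rewrite epw odd_w in even_p.
  by rewrite even ?orbT.
- move=> odd_p /predU1P [->|p_ws].
    exists i; split=> [|k]; first by rewrite in_cons root orbT.
    rewrite in_cons => /predU1P [|/ext [q]].
      by rewrite -[rcons w k]cats0 => /rcons_cat_neq.
    by rewrite -[rcons w k]cats0 => /rcons_cat_inj.
  have [k [pk k_uniq]] := oddP _ odd_p p_ws.
  exists k; split=> [|k']; first by rewrite in_cons pk orbT.
  rewrite in_cons => /predU1P [epk|]; last exact: k_uniq.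
  have [q ep] := ext _ p_ws; move: epk; rewrite ep rcons_cat.
  by move/rcons_cat_neq.
- move=> /predU1P [->|p_ws] no_k.
    by have := no_k i; rewrite in_cons root orbT.
  by apply: leaf => // k; have := no_k k; rewrite in_cons negb_or => /andP [].
Qed.

(** All [n] children of a clause node are kept, so one subtree per child is chosen and their union
    taken. For [n = 0] the node itself is the closed leaf. *)
Lemma success_below_clause p n :
  ~~ odd (size p) -> T p <> None -> (forall j, T (rcons p j) <> None <-> j < n) ->
  (forall j, j < n -> exists ws, success_below (rcons p j) ws) ->
  (n = 0 -> closed_leaf T p) ->
  exists ws, success_below p ws.
Proof.
move=> even_p Tp Tpj ex_ws leaf_p.
(* Padding with the empty list beyond [n] makes the choice a total function of [j]. *)
have ex_W j : exists ws, j < n -> success_below (rcons p j) ws.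
  have [lt_j|ge_j] := ltnP j n; last by exists [::].
  by have [ws wsP] := ex_ws j lt_j; exists ws.
pose W j := proj1_sig (constructive_indefinite_description _ (ex_W j)).
have WP j : j < n -> success_below (rcons p j) (W j).
  exact: proj2_sig (constructive_indefinite_description _ (ex_W j)).
pose ws := p :: flatten [seq W j | j <- iota 0 n].
have wsP q : q \in ws <-> q = p \/ exists2 j, j < n & q \in W j.
  rewrite in_cons; split.
    case/predU1P => [->|/flattenP [V /mapP [j]]]; first by left.
    by rewrite mem_iota => lt_j -> qV; right; exists j.
  case=> [->|[j lt_j qj]]; first by rewrite eqxx.
  apply/orP; right; apply/flattenP; exists (W j) => //.
  by apply: map_f; rewrite mem_iota.
have W_neq j q : j < n -> q \in W j -> q <> p.
  by move=> /WP/sb_ext ext /ext [q' ->]; exact: rcons_cat_neq.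
exists ws; split=> [|q /wsP|q /wsP|q k /wsP|q k even_q /wsP|q odd_q /wsP|q /wsP].
- by apply/wsP; left.
- case=> [->|[j /WP/sb_ext ext /ext [q' ->]]]; first by exists [::]; rewrite cats0.
  by exists (j :: q'); rewrite cat_rcons.
- by case=> [->|[j /WP/sb_dom dom /dom]].
- case=> [->|[j lt_j qj]]; first by left.
  right; apply/wsP; have [/rcons_inj [-> _]|qW] := sb_prefix (WP j lt_j) qj.
    by left.
  by right; exists j.
- move=> q_ws Tqk; apply/wsP; right.
  case: q_ws Tqk even_q => [-> /Tpj lt_k _|[j lt_j qj] Tqk even_q].
    by exists k => //; exact: sb_root (WP k lt_k).
  by exists j => //; apply: (sb_even (WP j lt_j)).
- case=> [eqp|[j lt_j qj]]; first by rewrite -eqp odd_q in even_p.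
  have [k [qk k_uniq]] := sb_odd (WP j lt_j) odd_q qj.
  exists k; split=> [|k' /wsP]; first by apply/wsP; right; exists j.
  have [r eq_q] := sb_ext (WP j lt_j) qj.
  case=> [|[j' lt_j' qk']]; first by rewrite eq_q rcons_cat => /rcons_cat_neq.
  (* Positions in [W j] extend [rcons p j], so [q] and its child cannot lie under different children
     of [p]. *)
  suff ejj' : j = j' by apply: k_uniq; rewrite ejj'.
  have [r'] := sb_ext (WP j' lt_j') qk'.
  by rewrite eq_q rcons_cat => /rcons_cat_inj.
- case=> [->|[j lt_j qj]] no_k.
    apply: leaf_p; case: (n) wsP WP => // n' wsP' WP'.
    case/negP: (no_k 0); apply/wsP'; right; exists 0 => //.
    exact: sb_root (WP' 0 _).
  apply: (sb_leaf (WP j lt_j)) qj _ => k; apply/negP => qk.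
  by case/negP: (no_k k); apply/wsP; right; exists j.
Qed.

Lemma success_below_root ws : success_below [::] ws -> inductive_success T.
Proof.
move=> [root ext dom pre even oddP leaf]; exists (fun w => w \in ws); split.
- split=> // w i /pre [|//]; by case: w.
- by exists ws.
- by move=> w w_ws no_i; apply: leaf => // i; apply/negP/no_i.
Qed.

End Subtrees.

(** * Rewriting trees *)

Section RewritingTrees.
Variables (S : signature) (rn : renaming S) (P : program S) (C : clause S).
Implicit Types (s d th ga : substitution S) (w : position) (u g B : term S).

(* Labels of the children are computed from the label of the parent, an open
   or-node being labelled with the code of its position. *)
Definition or_label s w (K : rule S) u : label S :=
  let K' := variant (rn C w) K in
  match excluded_middle_informative (exists th, mgm (Defs.head K') u th) with
  | left ex => LClause (RuleClause (rsubst s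
      (rsubst (proj1_sig (constructive_indefinite_description _ ex)) K')))
  | right _ => LOpen (pickle w)
  end.

Definition child_label s w (l : option (label S)) i : option (label S) :=
  match l with
  | Some (LClause D) => omap (@LTerm S) (onth (cbody D) i)
  | Some (LTerm u) => omap (fun K => or_label s (rcons w i) K u) (onth P i)
  | _ => None
  end.

Fixpoint rew_from s w (l : option (label S)) (q : position) : option (label S) :=
  if q is i :: q' then rew_from s (rcons w i) (child_label s w l i) q' else l.

Definition rew_tree s : tree S :=
  rew_from s [::] (Some (LClause (csubst s C))).

(** [rew_from] reads positions from the root, whereas [is_rew] extends them at the end; generalizing
    over the prefix already read reconciles the two. *)
Lemma rew_tree_rcons s w i :
  rew_tree s (rcons w i) = child_label s w (rew_tree s w) i.
Proof.
rewrite /rew_tree -[in child_label s w](cat0s w).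
elim: w [::] (Some _) => [|j w IH] p l /=; first by rewrite cats0.
by rewrite IH cat_rcons.
Qed.

Lemma rew_tree_open s w X : rew_tree s w = Some (LOpen X) -> X = pickle w.
Proof.
case/lastP: w => [//|w i]; rewrite rew_tree_rcons /child_label.
case: (rew_tree s w) => [[u|D|//]|//]; last by case: onth.
case: (onth P i) => [K|//] /=; rewrite /or_label.
by case: excluded_middle_informative => // ? [].
Qed.

(** The matcher chosen inside [or_label] is immaterial, since [mgm_unique] makes all most general
    matchers agree pointwise. *)
Lemma or_label_mgm s w K u th :
  mgm (Defs.head (variant (rn C w) K)) u th ->
  or_label s w K u = LClause (RuleClause (rsubst s (rsubst th (variant (rn C w) K)))).
Proof.
move=> th_m; rewrite /or_label.
case: excluded_middle_informative => [ex|[]]; last by exists th.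
case: constructive_indefinite_description => th' /= th'_m.
have th'E B : tsubst th' B = tsubst th B by apply/eq_tsubst/(mgm_unique th'_m).
by rewrite /rsubst th'E (eq_map th'E).
Qed.

Lemma or_label_open s w K u :
  (forall th, ~ mgm (Defs.head (variant (rn C w) K)) u th) ->
  or_label s w K u = LOpen (pickle w).
Proof.
move=> no_th; rewrite /or_label; case: excluded_middle_informative => // ex.
by have [th /no_th] := ex.
Qed.

Lemma rew_exists s : idempotent_sub s -> is_rew rn P C s (rew_tree s).
Proof.
move=> idem_s; split=> // [i|w u i odd_w Tw|w X i Tw|w i Tw|w w' X].
- rewrite (rew_tree_rcons s [::]) /=.
  have -> : cbody (csubst s C) = map (tsubst s) (cbody C) by case: (C).
  by rewrite onth_map; case: onth.
- rewrite /or_child rew_tree_rcons Tw /=; case PK: (onth P i) => [K|] //=.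
  split=> [th th_m|no_th]; last by exists (pickle (rcons w i)); rewrite or_label_open.
  rewrite (or_label_mgm s th_m); split=> // j.
  rewrite rew_tree_rcons (rew_tree_rcons s w) Tw /= PK /= (or_label_mgm s th_m) /=.
  by rewrite !onth_map; case: onth.
- by rewrite rew_tree_rcons Tw.
- by rewrite rew_tree_rcons Tw.
- move=> /rew_tree_open -> /rew_tree_open e.
  by have := congr1 (@unpickle position) e; rewrite !pickleK => -[].
Qed.

(** [node] and [success] describe term nodes and successful subtrees reached through matched
    or-nodes without mentioning a tree, hence independently of the or-node variables; this lets them
    be carried along transitions. *)
Inductive node s : position -> term S -> Prop :=
| NodeGoal i B : onth (cbody C) i = Some B -> node s [:: i] (tsubst s B)
| NodeBody w u i K th j B :
    node s w u -> onth P i = Some K ->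
    let K' := variant (rn C (rcons w i)) K in
    mgm (Defs.head K') u th -> onth (body K') j = Some B ->
    node s (rcons (rcons w i) j) (tsubst s (tsubst th B)).

Inductive success s : position -> term S -> Prop :=
| Success w u i K th :
    onth P i = Some K ->
    let K' := variant (rn C (rcons w i)) K in
    mgm (Defs.head K') u th ->
    (forall j B, onth (body K') j = Some B ->
       success s (rcons (rcons w i) j) (tsubst s (tsubst th B))) ->
    success s w u.

Lemma node_odd s w u : node s w u -> odd (size w).
Proof. by elim=> // *; rewrite !size_rcons /= negbK. Qed.

Lemma node_fix s w u : idempotent_sub s -> node s w u -> tsubst s u = u.
Proof. by move=> idem_s; case=> *; exact: idempotent_tsubst. Qed.

Lemma node_label s T w u :
  is_rew rn P C s T -> node s w u -> T w = Some (LTerm u).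
Proof.
move=> Trew; elim=> {w u} [i B CB|w u i K th j B nw Tw PK K' th_m KB].
  by rewrite (rew_goals Trew) CB.
have := rew_or Trew i (node_odd nw) Tw; rewrite /or_child PK.
by case=> /(_ _ th_m) [_ ->] _; rewrite -/K' KB.
Qed.

Lemma node_lift s s' d w u :
  idempotent_sub s -> idempotent_sub s' -> s' =1 scomp d s ->
  node s w u -> node s' w (tsubst d u).
Proof.
move=> idem_s idem_s' s's; elim=> {w u} [i B CB|w u i K th j B nw IH PK K' th_m KB].
  by rewrite -tsubst_scomp -(eq_tsubst _ s's); exact: NodeGoal.
have [th' th'_m E] := mgm_lift idem_s idem_s' s's (node_fix idem_s nw) th_m.
by rewrite -E; exact: NodeBody IH PK th'_m KB.
Qed.

Lemma success_lift s s' d w u :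
  idempotent_sub s -> idempotent_sub s' -> s' =1 scomp d s ->
  tsubst s u = u -> success s w u -> success s' w (tsubst d u).
Proof.
move=> idem_s idem_s' s's su suc; elim: suc su => {w u} w u i K th PK K' th_m _ IH su.
have [th' th'_m E] := mgm_lift idem_s idem_s' s's su th_m.
apply: (Success PK th'_m) => j B KB; rewrite E; apply: IH KB _.
exact: idempotent_tsubst.
Qed.

Lemma success_subtree s T w u :
  is_rew rn P C s T -> success s w u -> odd (size w) -> T w = Some (LTerm u) ->
  exists ws, success_below T w ws.
Proof.
move=> Trew; elim=> {w u} w u i K th PK K' th_m _ IH odd_w Tw.
have := rew_or Trew i odd_w Tw; rewrite /or_child PK.
case=> /(_ _ th_m) [Twi Twij] _; rewrite -/K' in Twi Twij.
have even_wi : ~~ odd (size (rcons w i)) by rewrite size_rcons /= odd_w.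
suff [ws wsP] : exists ws, success_below T (rcons w i) ws.
  by exists (w :: ws); apply: success_below_term wsP; rewrite ?Tw.
apply: (@success_below_clause _ _ _ (size (body K'))) => //.
- by rewrite Twi.
- by move=> j; rewrite Twij -onthTE; case: onth.
- move=> j; rewrite -onthTE; case KB: (onth _ j) => [B|//] _.
  by apply: (IH _ _ KB); rewrite ?Twij ?KB // size_rcons oddS even_wi.
- move=> K'0; split=> //; [by rewrite size_rcons | by eexists; exact: Twi |].
  by move=> j; rewrite Twij (size0nil K'0) onth0n.
Qed.

(** The body has to be nonempty because a closed leaf has positive length, so the root cannot be
    one. *)
Lemma success_inductive s T :
  is_rew rn P C s T ->
  (forall i B, onth (cbody C) i = Some B -> success s [:: i] (tsubst s B)) ->
  0 < size (cbody C) -> inductive_success T.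
Proof.
move=> Trew suc C0.
suff [ws /success_below_root] : exists ws, success_below T [::] ws by [].
apply: (@success_below_clause _ _ _ (size (cbody C))) => //.
- by rewrite (rew_root Trew).
- by move=> j; rewrite (rew_goals Trew) -onthTE; case: onth.
- move=> j; rewrite -onthTE; case CB: (onth _ j) => [B|//] _.
  by apply: (success_subtree Trew (suc _ _ CB)); rewrite // (rew_goals Trew) CB.
- by move=> C00; rewrite C00 in C0.
Qed.

End RewritingTrees.

Lemma lhm_ground (S : signature) (P : program S) (g : term S) : lhm P g -> ground g.
Proof. by case=> i K sg _ gsg _; exact: grounding_tsubst. Qed.

(** * Completeness *)

Section Resolution.
Variables (S : signature) (rn : renaming S) (P : program S) (t : term S).
Implicit Types (s d th ga : substitution S) (w : position) (u g B : term S).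
Implicit Types (x : var) (V : var -> Prop).

Let C := GoalClause [:: t].

(** Requiring [is_rew] of the last tree excludes the empty tree, so that a further transition can
    start there. *)
Definition reachable s : Prop := exists n T (ths : nat -> substitution S),
  [/\ S_derivation rn P t n T ths, is_rew rn P C (answer ths n) (T n)
    & s = answer ths n].

Lemma reachable_id : reachable (@idsub S).
Proof.
have T0 : is_rew rn P C (@idsub S) (rew_tree rn P C (@idsub S)) by exact: rew_exists.
by exists 0, (fun=> rew_tree rn P C (@idsub S)), (fun=> @idsub S).
Qed.

Lemma reachable_idem s : reachable s -> idempotent_sub s.
Proof. by case=> n [T [th [_ Tn ->]]]; exact: rew_idem Tn. Qed.

Lemma reachable_step s w u i K th :
  reachable s -> node rn P C s w u -> onth P i = Some K ->
  let A := Defs.head (variant (rn C (rcons w i)) K) in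
  (forall th', ~ mgm A u th') -> mgu A u th -> idempotent_sub (scomp th s) ->
  reachable (scomp th s).
Proof.
move=> [n [T [ths [[T0 step] Tn ->]]]] nw PK A no_mgm th_mgu idem.
have Tw := node_label Tn nw.
have [X TX] : exists X, T n (rcons w i) = Some (LOpen X).
  by have := rew_or Tn i (node_odd nw) Tw; rewrite /or_child PK => -[_]; apply.
(* A derivation of length [n] has [n.+1] trees but [n] resolvents, whence the two different
   guards. *)
pose T' k := if k <= n then T k else rew_tree rn P C (scomp th (answer ths n)).
pose ths' k := if k < n then ths k else th.
have ans k : k <= n -> answer ths' k = answer ths k.
  by elim: k => //= k IH lt_k; rewrite {1}/ths' lt_k IH // ltnW.
have ansS : answer ths' n.+1 = scomp th (answer ths n).
  by rewrite /= ans // /ths' ltnn.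
have T'S : is_rew rn P C (scomp th (answer ths n)) (T' n.+1).
  by rewrite /T' ltnn; exact: rew_exists.
exists n.+1, T', ths'; rewrite ansS; split=> //; split=> [|k]; first by rewrite /T'.
rewrite ltnS leq_eqVlt => /predU1P [->|lt_k].
  rewrite ans // {1}/T' leqnn /ths' ltnn; split=> //.
  by exists w, i, X, u, K; split=> //; left.
by rewrite ans ?(ltnW lt_k) // /T' /ths' lt_k (ltnW lt_k); exact: step.
Qed.

(* The variables of all clause copies that may be used under position [w]. *)
Definition below w x : Prop := exists q y, x = rn C (w ++ q) y.

(* [ga] is the solution being approximated: [s] only carries out the part of it
   that has been forced so far. *)
Record state V s ga : Prop := State {
  st_reach : reachable s;
  st_supp : supported V s;
  st_ga : scomp ga s =1 ga }.

Lemma st_gaE V s ga u : state V s ga -> tsubst ga (tsubst s u) = tsubst ga u.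
Proof. by move=> st; rewrite -tsubst_scomp; apply/eq_tsubst/(st_ga st). Qed.

Lemma state_sub V V' s ga :
  (forall x, V x -> V' x) -> state V s ga -> state V' s ga.
Proof. by move=> VV' [r v e]; split=> //; exact: supported_sub v. Qed.

(** The induction statement of completeness. [V] holds the variables in use; the copies below [w]
    are still untouched, so [ga] may be redefined there without spoiling equations solved elsewhere.
    The factor [d] is what transports earlier successes from [s] to [s']. *)
Definition resolves w g : Prop := forall s u V ga,
  state V s ga -> node rn P C s w u -> (forall x, below w x -> ~ V x) ->
  (forall x, occurs x u -> V x) -> tsubst ga u = g ->
  exists s' d ga', [/\ state (fun x => V x \/ below w x) s' ga', s' =1 scomp d s,
    forall x, ~ below w x -> ga' x = ga x & success rn P C s' w (tsubst d u)].

Lemma resolves_body V s ga w u i K th (sg : substitution S) :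
  state V s ga -> node rn P C s w u -> onth P i = Some K ->
  let K' := variant (rn C (rcons w i)) K in
  mgm (Defs.head K') u th ->
  (forall j x, below (rcons (rcons w i) j) x -> ~ V x) ->
  (forall x, occurs x u -> V x) -> (forall y, V (rn C (rcons w i) y)) ->
  (forall y, ga (rn C (rcons w i) y) = sg y) ->
  tsubst ga u = tsubst sg (Defs.head K) ->
  (forall j B, onth (body K) j = Some B ->
     resolves (rcons (rcons w i) j) (tsubst sg B)) ->
  forall m, exists s' d ga',
    [/\ state (fun x => V x \/ exists2 j, j < m & below (rcons (rcons w i) j) x) s' ga',
        s' =1 scomp d s,
        forall x, (forall j, ~ below (rcons (rcons w i) j) x) -> ga' x = ga x
      & forall j B, j < m -> onth (body K') j = Some B ->
          success rn P C s' (rcons (rcons w i) j) (tsubst d (tsubst s (tsubst th B)))].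
Proof.
move=> st nw PK K' th_m disj Vu Vwi ga_wi ga_u IH; elim=> [|m [s' [d [ga' [st' s's ga'E suc]]]]].
  exists s, (@idsub S), ga; split=> //; first by apply: state_sub st => x; left.
  by move=> x; rewrite /scomp tsubst_id.
have s'E v : tsubst d (tsubst s v) = tsubst s' v.
  by rewrite -tsubst_scomp; symmetry; exact: eq_tsubst.
(* Past the end of the body there is nothing to resolve and the state is kept. *)
case KB: (onth (body K) m) => [B|]; last first.
  exists s', d, ga'; split=> //.
    by apply: state_sub st' => x [|[j lt_j]]; [left | right; exists j; rewrite // ltnW].
  move=> j B'; rewrite ltnS leq_eqVlt => /predU1P [->|]; last exact: suc.
  by rewrite /K' /= onth_map KB.
set v : substitution S := fun x => Var (rn C (rcons w i) x).
have K'B : onth (body K') m = Some (tsubst v B) by rewrite /= onth_map KB.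
have Vv y e : occurs y (tsubst v e) -> V y.
  by move/occurs_tsubst => [x _ /= ->].
have ga_v e : tsubst ga (tsubst v e) = tsubst sg e.
  by rewrite -tsubst_scomp; apply: eq_tsubst => x; exact: ga_wi.
have [th_h _ th_n] := th_m.
have V_th y e : occurs y (tsubst th (tsubst v e)) -> V y.
  move/occurs_tsubst => [x /Vv Vx]; have [xh|/th_n -> /= -> //] := classic (occurs x (Defs.head K')).
  by move=> yx; apply: Vu; rewrite -th_h; apply/occurs_tsubst; exists x.
(* [ga] absorbs [th]: on head variables because both [scomp ga th] and [ga] send the head of the
   copy to [tsubst ga u], elsewhere because [th] is the identity. *)
have ga_th e : tsubst ga (tsubst th (tsubst v e)) = tsubst sg e.
  rewrite -ga_v -tsubst_scomp; apply: eq_tsubst => x.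
  have [|/th_n e_x] := classic (occurs x (Defs.head K')); last by rewrite /scomp e_x.
  move: x; apply/eq_tsubst_in; rewrite tsubst_scomp th_h ga_u.
  by rewrite -ga_v.
have idem_s := reachable_idem (st_reach st).
have idem_s' := reachable_idem (st_reach st').
have nm := node_lift idem_s idem_s' s's (NodeBody nw PK th_m K'B).
have [||| s2 [d2 [ga2 [st2 s2s ga2E suc2]]]] := IH _ _ KB _ _ _ _ st' nm.
(* Copies below the distinct children [m] and [j] share no variable, by injectivity of [ren]. *)
- move=> x xm [/(disj _ _ xm)//|[j lt_j xj]].
  have [[q [y ->]] [q' [y' /ren_inj [/rcons_cat_inj e _]]]] := (xm, xj).
  by rewrite e ltnn in lt_j.
- move=> x; rewrite s'E; apply: supported_occurs (st_supp st') _ => y /V_th; by left.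
- rewrite s'E (st_gaE _ st') -ga_th; apply/eq_tsubst_in => x /V_th Vx.
  by apply: ga'E => j /disj.
have idem_s2 := reachable_idem (st_reach st2).
exists s2, (scomp d2 d), ga2; split.
- apply: state_sub st2 => x [[|[j lt_j xj]]|xm]; [by left | right..].
    by exists j; rewrite // ltnS ltnW.
  by exists m.
- by move=> x; rewrite s2s /scomp tsubst_scomp s's.
- by move=> x nx; rewrite ga2E // ga'E.
- move=> j B'; rewrite ltnS leq_eqVlt tsubst_scomp => /predU1P [->|lt_j K'B'].
    by rewrite K'B => -[<-].
  apply: (success_lift idem_s' idem_s2 s2s _ (suc _ _ lt_j K'B')).
  by rewrite s'E idempotent_tsubst.
Qed.

Lemma below_child w i j x : below (rcons (rcons w i) j) x -> below w x.
Proof. by move=> [q [y ->]]; exists (i :: j :: q), y; rewrite !cat_rcons. Qed.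

(** Induction on membership in M_P: the last clause applied selects the or-node [i] below [w], at
    most one transition closes it, and [resolves_body] treats the body. *)
Lemma lhm_resolves g : lhm P g -> forall w, resolves w g.
Proof.
elim=> {g} i K sg PK _ _ IH w s u V ga st nw disj Vu ga_u.
pose vs (x : var) : term S := Var (rn C (rcons w i) x).
pose A := Defs.head (variant (rn C (rcons w i)) K).
pose V1 x := V x \/ exists y, x = rn C (rcons w i) y.
have below_wi y : below w (rn C (rcons w i) y).
  by exists [:: i], y; rewrite cats1.
have disj1 j x : below (rcons (rcons w i) j) x -> ~ V1 x.
  move=> xj [/(disj _ (below_child xj))//|[y]].
  by have [q [y' ->]] := xj => /ren_inj [/rcons_cat_neq].
(* [ga] is overwritten with [sg] on the copy used at [rcons w i]: consistent because [ren] is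
   injective, harmless because this copy lies outside [V]. *)
have [ga1 ga1P] : exists ga1 : substitution S,
    (forall y, ga1 (rn C (rcons w i) y) = sg y) /\
    (forall x, ~ below w x -> ga1 x = ga x).
  have ex x : exists e, (forall y, x = rn C (rcons w i) y -> e = sg y) /\
      (~ below w x -> e = ga x).
    have [[y ->]|nx] := classic (exists y, x = rn C (rcons w i) y).
      by exists (sg y); split=> [y' /ren_inj [_ ->]|/(_ (below_wi y))].
    by exists (ga x); split=> // y xy; case: nx; exists y.
  exists (fun x => proj1_sig (constructive_indefinite_description _ (ex x))).
  by split=> [y|x nx]; case: constructive_indefinite_description => e /= [];
     [move=> /(_ y erefl) | move=> _ /(_ nx)].
have [ga1_wi ga1E] := ga1P.
have ga1_V x : V x -> ga1 x = ga x by move=> Vx; apply: ga1E => /disj.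
have st1 : state V1 s ga1.
  split; [exact: st_reach st | by apply: supported_sub (st_supp st) => x; left |].
  move=> x; rewrite /scomp; have [Vx|nVx] := classic (V x); last first.
    by rewrite (st_supp st x).2.
  rewrite (ga1_V _ Vx) -(st_ga st x); apply/eq_tsubst_in => y yx.
  by apply/ga1_V/((st_supp st x).1 Vx).
have ga1_u : tsubst ga1 u = tsubst sg (Defs.head K).
  by rewrite -ga_u; apply/eq_tsubst_in => x /Vu/ga1_V.
have ga1_A : tsubst ga1 A = tsubst sg (Defs.head K).
  by rewrite /A /= -tsubst_scomp; apply: eq_tsubst => x; exact: ga1_wi.
have idem_s := reachable_idem (st_reach st).
have V1u x : occurs x u -> V1 x by move/Vu; left.
(* A closed or-node needs no transition. At an open one [ga1] unifies [A] and [u], so a most general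
   unifier exists and serves as resolvent. *)
have [s1 [d1 [th1 [st2 s1s th1_m V1u1 ga1_u1]]]] : exists s1 d1 th1,
    [/\ state V1 s1 ga1, s1 =1 scomp d1 s, mgm A (tsubst d1 u) th1,
        forall x, occurs x (tsubst d1 u) -> V1 x
      & tsubst ga1 (tsubst d1 u) = tsubst sg (Defs.head K)].
  have [[th th_m]|no_th] := classic (exists th, mgm A u th).
    exists s, (@idsub S), th; rewrite tsubst_id; split=> // x.
    by rewrite /scomp tsubst_id.
  pose W x := occurs x A \/ occurs x u.
  have [||th [thE thG thW]] := @unify _ W ga1 _ A u ga1_A ga1_u.
  - by move=> x; left.
  - by move=> x; right.
  have idem_th : idempotent_sub th by exact: thG.
  have W_V1 x : W x -> V1 x.
    case=> [/occurs_tsubst [y _ /= ->]|/V1u//]; by right; exists y.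
  (* [s] has not touched the new copy, and being idempotent it fixes the variables of the node label
     [u]. *)
  have s_W x : W x -> s x = Var x.
    case=> [/occurs_tsubst [y _ /= ->]|].
      by apply: (st_supp st _).2; exact: disj.
    by move: x; apply/tsubst_fix; exact: node_fix nw.
  have idem_ths := idempotent_scomp idem_s idem_th thW s_W.
  have thV1 := supported_sub W_V1 thW.
  have ga1_th e : tsubst ga1 (tsubst th e) = tsubst ga1 e.
    rewrite -tsubst_scomp; apply/eq_tsubst/thG; by rewrite ga1_A.
  (* The or-node is now closed: [th] itself matches [A] against [tsubst th u]. *)
  have [th1 th1_m] := mgm_exists thE.
  exists (scomp th s), th, th1; split=> //; last by rewrite ga1_th.
    split.
    + apply: (reachable_step (st_reach st) nw PK) => //.
        by move=> th' th'_m; apply: no_th; exists th'.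
      by split=> // ta taE; exists ta; exact: thG.
    + by apply: supported_scomp => //; exact: st_supp st1.
    + by move=> x; rewrite /scomp ga1_th -[LHS]/(scomp ga1 s x) (st_ga st1).
  by move=> x; exact: supported_occurs.
have idem_s1 := reachable_idem (st_reach st2).
have nw1 := node_lift idem_s idem_s1 s1s nw.
have V1_wi y : V1 (rn C (rcons w i) y) by right; exists y.
have IHK j B KB := IH j B KB (rcons (rcons w i) j).
have [s2 [d2 [ga2 [st3 s2s ga2E suc]]]] :=
  resolves_body st2 nw1 PK th1_m disj1 V1u1 V1_wi ga1_wi ga1_u1 IHK (size (body K)).
have idem_s2 := reachable_idem (st_reach st3).
exists s2, (scomp d2 d1), ga2; split.
- apply: state_sub st3 => x [[|[y ->]]|[j _ /below_child]]; first by left.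
    by right.
  by right.
- by move=> x; rewrite s2s /scomp tsubst_scomp s1s.
- move=> x nx; rewrite ga2E ?ga1E // => j /below_child //.
- have [th2 th2_m E] := mgm_lift idem_s1 idem_s2 s2s (node_fix idem_s1 nw1) th1_m.
  rewrite tsubst_scomp; apply: (Success PK th2_m) => j B KB; rewrite E.
  apply: suc (KB); by rewrite -(size_map (tsubst vs)) -onthTE KB.
Qed.

Lemma refutation_complete : lhm P t -> exists theta, S_refutation rn P t theta.
Proof.
move=> Pt; have gt := lhm_ground Pt.
(* As [t] is ground, no variable is in use at the start, and the identity serves as initial [ga]. *)
have st : state (fun _ => False) (@idsub S) (@idsub S).
  by split; [exact: reachable_id | exact: supported_id | ].
have nt : node rn P C (@idsub S) [:: 0] t.
  by rewrite -[t in node _ _ _ _ _ t]tsubst_id; exact: NodeGoal.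
have V0 x : below [:: 0] x -> ~ False by move=> _ [].
have [s [d [ga [[r _ _] _ _ suc]]]] := lhm_resolves Pt st nt V0 gt (tsubst_id t).
have [n [T [th [der Tn es]]]] := r; exists (answer th n), n, T, th; split=> //.
apply: (success_inductive Tn) => // -[|i] B /=; last by rewrite onth0n.
by case=> <-; rewrite -es ground_tsubst // -[t](ground_tsubst d gt).
Qed.

End Resolution.

Theorem theorem3p15 (S : signature) (hS : has_constant S) (rn : renaming S)
    (P : program S) (t : term S) :
  (forall (theta : substitution S) (t' : term S),
     S_refutation rn P t theta ->
     ground t' -> instance_of t' (tsubst theta t) ->
     lhm P t')
  /\
  (lhm P t ->
     exists (t' : term S) (theta : substitution S),
       S_refutation rn P t' theta /\ instance_of t (tsubst theta t')).
Proof.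
split=> [theta t'|Pt]; first exact: refutation_sound.
have [theta ref] := refutation_complete rn Pt.
exists t, theta; split=> //; exists (@idsub S).
by rewrite tsubst_id ground_tsubst //; exact: lhm_ground Pt.
Qed.
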